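(* Let $\alpha\neq0$ be a real constant and $\epsilon>0$. Let $u_0\in L^\infty(\mathbb{R})\cap L^1(\mathbb{R})$ and let $v_0$ be a function of bounded variation which is in $L^1(\mathbb{R})$. Let $(u^\epsilon,v^\epsilon)$ be the explicit solution (given in the context) of $$u_t+\left(\tfrac{u^2}{2}\right)_x+\alpha u=\epsilon e^{-\alpha t}u_{xx},\qquad v_t+(uv)_x=\epsilon e^{-\alpha t}v_{xx},\qquad x\in\mathbb{R},\ t>0,$$ with initial conditions $u(x,0)=u_0(x)$, $v(x,0)=v_0(x)$. With $\tau(t)$, $G$, $H$, $G_\infty$, $H_\infty$ as defined in the context, the following hold. Case 1: if $\alpha>0$, then $$\lim_{t\to\infty}\frac{-1}{2\epsilon}e^{\alpha t}u^\epsilon(x,t)=\frac{G'(x)}{G(x)},\qquad \lim_{t\to\infty}v^\epsilon(x,t)=\frac{d}{dx}\left(\frac{H(x)}{G(x)}\right),$$ and these limits are uniform with respect to $x$ on compact subsets of $\mathbb{R}$. Case 2: if $\alpha<0$, then, with $x=\sqrt{2\epsilon\tau(t)}\,\xi$, $$\lim_{t\to\infty}\frac{-\sqrt{\tau(t)}}{\sqrt{2\epsilon}}\,e^{\alpha t}u^\epsilon(x,t)=\frac{G_\infty'(\xi)}{G_\infty(\xi)},\qquad \lim_{t\to\infty}\sqrt{2\epsilon\tau(t)}\,v^\epsilon(x,t)=\frac{d}{d\xi}\left(\frac{H_\infty(\xi)}{G_\infty(\xi)}\right),$$ and these limits are uniform with respect to $\xi$ on compact subsets of $\mathbb{R}$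.
   Context: Notation: $\tau(t)=\frac{1-e^{-\alpha t}}{\alpha}$, $U_0(y)=\int_0^y u_0(s)\,ds$, $V_0(y)=\int_0^y v_0(s)\,ds$, $\theta(x,y,\tau)=\frac{(x-y)^2}{2\tau}+U_0(y)$; $U_0(\pm\infty)$ and $V_0(\pm\infty)$ denote the limits of $U_0,V_0$ at $\pm\infty$. The explicit solution is $$u^\epsilon(x,t)=e^{-\alpha t}\,\frac{\int_{\mathbb{R}}\frac{x-y}{\tau(t)}\,e^{-\theta(x,y,\tau(t))/(2\epsilon)}\,dy}{\int_{\mathbb{R}}e^{-\theta(x,y,\tau(t))/(2\epsilon)}\,dy},\qquad v^\epsilon=\partial_x V^\epsilon,\qquad V^\epsilon(x,t)=\frac{\int_{\mathbb{R}}V_0(y)\,e^{-\theta(x,y,\tau(t))/(2\epsilon)}\,dy}{\int_{\mathbb{R}}e^{-\theta(x,y,\tau(t))/(2\epsilon)}\,dy}.$$ For $\alpha>0$ (so that $\tau(t)\to1/\alpha$ as $t\to\infty$): $$G(x)=\int_{\mathbb{R}}e^{-\frac{1}{2\epsilon}\theta(x,y,1/\alpha)}\,dy,\qquad H(x)=\int_{\mathbb{R}}V_0(y)\,e^{-\frac{1}{2\epsilon}\theta(x,y,1/\alpha)}\,dy.$$ For $\alpha<0$ (so that $\tau(t)\to\infty$ as $t\to\infty$): $$G_\infty(\xi)=e^{-\frac{U_0(+\infty)}{\epsilon}}\int_{-\infty}^{\xi}e^{-y^2/2}\,dy+e^{-\frac{U_0(-\infty)}{\epsilon}}\int_{\xi}^{\infty}e^{-y^2/2}\,dy,$$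 $$H_\infty(\xi)=e^{-\frac{U_0(+\infty)}{\epsilon}}V_0(+\infty)\int_{-\infty}^{\xi}e^{-y^2/2}\,dy+e^{-\frac{U_0(-\infty)}{\epsilon}}V_0(-\infty)\int_{\xi}^{\infty}e^{-y^2/2}\,dy.$$ In Case 2 the limits are taken as $t\to\infty$ with $\xi=x/\sqrt{2\epsilon\tau(t)}$ held fixed.
   Formalization: In G_∞ and H_∞ the factors e^{-U_0(±∞)/ε} are replaced by e^{-U_0(±∞)/(2ε)}; with the printed exponents the Case 2 limit of u^ε is false whenever U_0(+∞)≠U_0(−∞), e.g. u_0=1_{[0,1]}, v_0=0, ε=1, α=−1. *)

(* Defs.v *)
From HB Require Import structures.
From mathcomp Require Import all_boot all_order all_algebra.
From mathcomp Require Import all_classical all_reals all_analysis.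

Set Implicit Arguments.
Unset Strict Implicit.
Unset Printing Implicit Defensive.

Import Order.TTheory GRing.Theory Num.Theory.
Import numFieldNormedType.Exports.

Local Open Scope classical_set_scope.
Local Open Scope ring_scope.

Section explicit_solution.
Context {R : realType}.
Implicit Types (alpha eps s t x y xi : R) (f u v : R -> R).

Local Notation mu := (@lebesgue_measure R).

(* Finite total variation over the whole line; the library's
   [bounded_variation] is relative to a segment. *)
Definition bounded_variation_line f : Prop :=
  (ereal_sup [set total_variation ab.1 ab.2 f
             | ab in [set ab : R * R | (ab.1 <= ab.2)%R]] < +oo)%E.

(* The oriented integral of f from 0 to y: it changes sign when y < 0. *)
Definition primitive0 f y : R :=
  if 0 <= y then \int[mu]_(s in `[0, y]) f s
  else - \int[mu]_(s in `[y, 0]) f s.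

Definition primitive0_pinfty f : R := lim (primitive0 f y @[y --> +oo]).
Definition primitive0_ninfty f : R := lim (primitive0 f y @[y --> -oo]).

Definition tau alpha t : R := (1 - expR (- alpha * t)) / alpha.

Definition theta u0 x y s : R := (x - y) ^+ 2 / (2 * s) + primitive0 u0 y.

Definition weight eps u0 x y s : R := expR (- (theta u0 x y s / (2 * eps))).

Definition u_eps alpha eps u0 x t : R :=
  expR (- alpha * t) *
  (\int[mu]_y ((x - y) / tau alpha t * weight eps u0 x y (tau alpha t)) /
   \int[mu]_y weight eps u0 x y (tau alpha t)).

Definition V_eps alpha eps u0 v0 x t : R :=
  \int[mu]_y (primitive0 v0 y * weight eps u0 x y (tau alpha t)) /
  \int[mu]_y weight eps u0 x y (tau alpha t).

Definition v_eps alpha eps u0 v0 x t : R :=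
  derive1 (fun z => V_eps alpha eps u0 v0 z t) x.

Definition G alpha eps u0 x : R := \int[mu]_y weight eps u0 x y (1 / alpha).

Definition H alpha eps u0 v0 x : R :=
  \int[mu]_y (primitive0 v0 y * weight eps u0 x y (1 / alpha)).

Definition gauss_left xi : R := \int[mu]_(y in `]-oo, xi]) expR (- (y ^+ 2 / 2)).
Definition gauss_right xi : R := \int[mu]_(y in `[xi, +oo[) expR (- (y ^+ 2 / 2)).

(* The denominators in the two exponents below are 2 * eps, not eps: this is
   the value dictated by the kernel exp (- theta / (2 * eps)), as one sees by
   substituting y = sqrt (2 * eps * tau) * eta in the explicit formulas and
   letting tau tend to infinity.  With exp (- U_0(+oo) / eps) and
   exp (- U_0(-oo) / eps) instead, the limit of u fails as soon as the integral
   of u0 is nonzero: at xi = 0 the limit is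
     sqrt (2 / pi) * (a - b) / (a + b),  a, b = exp (- U_0(+oo, -oo) / (2 eps)),
   and not the same expression in a ^ 2 and b ^ 2. *)
Definition G_inf eps u0 xi : R :=
  expR (- (primitive0_pinfty u0 / (2 * eps))) * gauss_left xi +
  expR (- (primitive0_ninfty u0 / (2 * eps))) * gauss_right xi.

Definition H_inf eps u0 v0 xi : R :=
  expR (- (primitive0_pinfty u0 / (2 * eps))) * primitive0_pinfty v0
    * gauss_left xi +
  expR (- (primitive0_ninfty u0 / (2 * eps))) * primitive0_ninfty v0
    * gauss_right xi.

End explicit_solution.

(* Main.v *)
Require Import Defs.
From HB Require Import structures.
From mathcomp Require Import all_boot all_order all_algebra.
From mathcomp Require Import all_classical all_reals all_analysis.
From mathcomp Require Import measurable_realfun ring lra.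

Set Implicit Arguments.
Unset Strict Implicit.
Unset Printing Implicit Defensive.

Import Order.TTheory GRing.Theory Num.Theory.
Import numFieldNormedType.Exports.

Local Open Scope classical_set_scope.
Local Open Scope ring_scope.

(* Put phi = exp (- U_0 / (2 eps)), psi = V_0 phi and c = 1 / (4 eps tau).  The
   integrals in the explicit solution are the convolutions N of phi and E of psi
   with the Gaussian exp (- c z^2), and the factor x - y in the numerator of u
   comes from the derivative of that Gaussian, so that
     u = - 2 eps exp (- alpha t) N' / N   and   v = (E / N)'.
   If alpha > 0, c tends to its value at tau = 1 / alpha.  If alpha < 0, the
   substitution y = s eta, s = sqrt (2 eps tau), turns c into 1 / 2 and phi, psi
   into phi (s eta), psi (s eta), which converge for eta != 0 to step functions;
   the Gaussian convolutions of these are G_inf and H_inf.  In both cases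
   dominated convergence gives the limit along t_n -> +oo and x_n -> x jointly,
   which amounts to uniform convergence on compact sets. *)

(** * From sequential limits to uniform convergence on compact sets *)

(** Convergence along all joint sequences gives, at each point x, an estimate valid for all large t
    and all y near x. It also makes g continuous, and compactness turns these local estimates into a
    uniform one. *)
Lemma seq_cvg_family_compact {R : realType} (f : R -> R -> R) (g : R -> R) :
  (forall (t_ x_ : R^nat) x, t_ n @[n --> \oo] --> +oo -> x_ n @[n --> \oo] --> x ->
    f (t_ n) (x_ n) @[n --> \oo] --> g x) ->
  {family compact, f t @[t --> +oo] --> g}.
Proof.
move=> fg.
have joint x e : 0 < e -> exists2 d, 0 < d &
    forall t y, d^-1 < t -> `|x - y| < d -> `|g x - f t y| < e.
  move=> e0; apply: contrapT => nd.
  (* If no d works, then d = 1/(n+1) fails for every n. The chosen counterexamples form a sequence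
     tending to (+oo, x) along which f stays at distance at least e from g x. *)
  have bad n : exists p : R * R, [/\ n.+1%:R < p.1, `|x - p.2| < n.+1%:R^-1 &
      e <= `|g x - f p.1 p.2| ].
    apply: contrapT => nb; apply: nd; exists n.+1%:R^-1; first by rewrite invr_gt0.
    move=> t y; rewrite invrK => tn xy; rewrite ltNge; apply/negP => ef.
    by apply: nb; exists (t, y).
  have [p p_bad] := choice bad.
  have t_oo : (p n).1 @[n --> \oo] --> +oo.
    apply/cvgryPgt => A; near=> n.
    have [+ _ _] := p_bad n; apply: lt_trans.
    rewrite -natr1 ltr_wpDr//; near: n; exact: nbhs_infty_gtr.
  have x_x : (p n).2 @[n --> \oo] --> x.
    apply/cvgrPdist_lt => r r0; near=> n.
    have [_ + _] := p_bad n; move=> /lt_trans; apply.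
    by near: n; exact: near_infty_natSinv_lt (PosNum r0).
  have /cvgrPdist_lt/(_ _ e0)[N _ /(_ N (leqnn N))/=] := fg _ _ _ t_oo x_x.
  by have [_ _] := p_bad N; rewrite leNgt => /negP.
apply/fam_cvgP => A cA.
move=> P /uniform_nbhs[E [eE EP]].
have : entourage_ ball E by rewrite entourage_ballE.
move=> [e /= e0 eE'].
suff : \forall t \near +oo, A `<=` [set x | `|g x - f t x| < e].
  move=> /= Ft; apply: filterS Ft => t At; apply: EP => y Ay /=.
  by apply: eE'; exact: At.
have /compact_near_coveringP := cA; apply => x Ax.
have e20 : 0 < e / 2 by rewrite divr_gt0.
have [d d0 dP] := joint x _ e20.
(* Continuity of g at x: the constant sequence y along t = n gives f n y -> g y, so the joint
   estimate passes to the limit as a weak inequality. *)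
have gx y : `|x - y| < d -> `|g x - g y| <= e / 2.
  move=> xy; have fy : f n%:R y @[n --> \oo] --> g y.
    by apply: (fg (fun n => n%:R) (cst y)); [exact: cvgr_idn|exact: cvg_cst].
  have : `|g x - f n%:R y| @[n --> \oo] --> `|g x - g y|.
    by apply: cvg_norm; apply: cvgB => //; exact: cvg_cst.
  move=> /cvgr_to_le; apply; near=> n; apply/ltW/dP => //.
  by near: n; exact: nbhs_infty_gtr.
near=> x' t => /=.
have xx' : `|x - x'| < d by near: x'; exact: nbhsx_ballx.
rewrite (splitr e) (le_lt_trans (ler_distD (g x) _ _))// ler_ltD//.
  by rewrite distrC; exact: gx.
by apply: dP => //; near: t; exact/nbhs_pinfty_gt/num_real.
Unshelve. all: end_near. Qed.

(** * Bounds and integrability of the Gaussian kernel *)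

Section gaussian_kernel.
Context {R : realType}.
Implicit Types (a b c x y z : R).

Local Notation mu := (@lebesgue_measure R).

Definition gker c z : R := expR (- (c * z ^+ 2)).

Definition dgker c z : R := - (2 * c * z) * gker c z.

Lemma gker_gt0 c z : 0 < gker c z. Proof. exact: expR_gt0. Qed.

Lemma gker_ge0 c z : 0 <= gker c z. Proof. exact: expR_ge0. Qed.

Lemma ler_gker a c z : a <= c -> gker c z <= gker a z.
Proof. by move=> ac; rewrite ler_expR lerN2 ler_wpM2r ?sqr_ge0. Qed.

(** Completing the square: the exponents differ by 2 c (x - y/2)^2. Half of the rate pays for taking
    the translation x out of the Gaussian. *)
Lemma gker_shift c x y : 0 <= c ->
  gker c (x - y) <= expR (c * x ^+ 2) * gker (c / 2) y.
Proof.
move=> c0; rewrite -expRD ler_expR -subr_ge0.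
have -> : c * x ^+ 2 - c / 2 * y ^+ 2 - - (c * (x - y) ^+ 2)
          = c * (2 * (x - y / 2) ^+ 2) by field.
by rewrite mulr_ge0// mulr_ge0// sqr_ge0.
Qed.

(** One half of the Gaussian absorbs the linear factor. With p = c z^2 / 2, the inequality 2|z| <= 1
    + z^2 bounds it by c + 2p <= (c + 2)(1 + p) <= (c + 2) exp p. *)
Lemma normr_dgker c z : 0 <= c -> `|dgker c z| <= (c + 2) * gker (c / 2) z.
Proof.
move=> c0; rewrite normrM [X in _ * X]ger0_norm ?gker_ge0// normrN.
have -> : gker c z = gker (c / 2) z * gker (c / 2) z.
  by rewrite -expRD; congr expR; field.
rewrite mulrA ler_pM2r ?gker_gt0//.
rewrite /gker expRN -ler_pdivlMr ?invr_gt0 ?expR_gt0// invrK.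
have e1 := expR_ge1Dx (c / 2 * z ^+ 2).
have p0 : 0 <= c / 2 * z ^+ 2 by rewrite mulr_ge0 ?sqr_ge0// divr_ge0.
have zz : `|z| * 2 <= 1 + z ^+ 2.
  by rewrite -real_normK ?num_real//; have := sqr_ge0 (`|z| - 1); nra.
rewrite !normrM (ger0_norm c0) ger0_norm//.
apply: (@le_trans _ _ (c + c * z ^+ 2)); first by nra.
by nra.
Qed.

(** A single integrable envelope for all rates in [a, b] and all centres in [-B, B]; [gker_shift] at
    rate c/2 leaves c/4 >= a/4. *)
Lemma gker_dom a b c B x y : 0 < a -> a <= c <= b -> `|x| <= B ->
  gker (c / 2) (x - y) <= expR (b * B ^+ 2) * gker (a / 4) y.
Proof.
move=> a0 /andP[ac cb] xB.
have c0 : 0 < c by exact: lt_le_trans ac.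
apply: (le_trans (gker_shift _ _ _)); first by rewrite divr_ge0 // ltW.
apply: ler_pM; rewrite ?expR_ge0 ?gker_ge0//.
  rewrite ler_expR; apply: ler_pM; rewrite ?sqr_ge0 ?divr_ge0 ?(ltW c0)//.
    by lra.
  by rewrite -real_normK ?num_real// ler_sqr ?nnegrE// (le_trans _ xB).
by apply: ler_gker; lra.
Qed.

Lemma measurable_gker c : measurable_fun [set: R] (gker c).
Proof.
apply: measurableT_comp => //; apply: measurableT_comp => //.
by apply: measurable_funM => //; exact: measurable_funX.
Qed.

(** Up to its peak value the kernel is the normal density of variance 1/(2c), from which it inherits
    integrability and a positive total mass. *)
Lemma gker_normal_pdf c x y : 0 < c ->
  gker c (y - x) = (normal_peak (Num.sqrt ((2 * c)^-1)))^-1 *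
                   normal_pdf x (Num.sqrt ((2 * c)^-1)) y.
Proof.
move=> c0; set s := Num.sqrt _.
have c20 : 0 < (2 * c)^-1 by rewrite invr_gt0 mulr_gt0.
have s0 : s != 0 by rewrite gt_eqF// sqrtr_gt0.
rewrite normal_pdfE// mulKf ?gt_eqF ?normal_peak_gt0//.
rewrite /normal_fun /gker sqr_sqrtr ?ltW//; congr expR.
by rewrite -mulr_natr; field; rewrite gt_eqF.
Qed.

Lemma integrable_gker c : 0 < c -> mu.-integrable [set: R] (EFin \o gker c).
Proof.
move=> c0; pose s := Num.sqrt ((2 * c)^-1).
have -> : EFin \o gker c =
    (fun y => ((normal_peak s)^-1)%:E * (normal_pdf 0 s y)%:E)%E.
  by apply/funext => y; rewrite /= -[y in LHS]subr0 gker_normal_pdf.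
by apply: integrableZl => //; exact: integrable_normal_pdf.
Qed.

End gaussian_kernel.

(** * Gaussian convolutions: domination, limits and derivative *)

Section gaussian_convolution.
Context {R : realType}.
Implicit Types (a b c x y z M : R) (k : R -> R -> R) (phi : R -> R).

Local Notation mu := (@lebesgue_measure R).

(** The properties common to [gker] and [dgker], so that integrability, limits and rescaling are
    treated once for both. The bound has the form found in [normr_dgker]. *)
Definition gaussian_family k := [/\ forall c, measurable_fun [set: R] (k c),
  forall c z, 0 <= c -> `|k c z| <= (c + 2) * gker (c / 2) z &
  forall (c_ z_ : R^nat) c z, c_ n @[n --> \oo] --> c -> z_ n @[n --> \oo] --> z ->
    k (c_ n) (z_ n) @[n --> \oo] --> k c z].

Definition gconv (k : R -> R) phi x : R := \int[mu]_y (phi y * k (x - y)).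

Lemma cvg_gker (c_ z_ : R^nat) c z :
  c_ n @[n --> \oo] --> c -> z_ n @[n --> \oo] --> z ->
  gker (c_ n) (z_ n) @[n --> \oo] --> gker c z.
Proof.
move=> cc zz; apply: continuous_cvg; first exact: continuous_expR.
by apply: cvgN; apply: cvgM => //; rewrite expr2; apply: cvgM.
Qed.

Lemma gaussian_family_gker : gaussian_family gker.
Proof.
split; [exact: measurable_gker| |exact: cvg_gker].
move=> c z c0; rewrite ger0_norm ?gker_ge0//.
rewrite (@le_trans _ _ (gker (c / 2) z))//; first by apply: ler_gker; lra.
by rewrite ler_peMl ?gker_ge0//; lra.
Qed.

Lemma gaussian_family_dgker : gaussian_family dgker.
Proof.
split; [|exact: normr_dgker|].
- move=> c; apply: measurable_funM; last exact: measurable_gker.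
  by apply: measurableT_comp => //; exact: measurable_funM.
- move=> c_ z_ c z cc zz; apply: cvgM; last exact: cvg_gker.
  by apply: cvgN; apply: cvgM => //; apply: cvgM => //; exact: cvg_cst.
Qed.

Lemma measurable_gconv_integrand k c phi x : gaussian_family k ->
  measurable_fun [set: R] phi ->
  measurable_fun [set: R] (fun y => phi y * k c (x - y)).
Proof.
move=> [mk _ _] mphi; apply: measurable_funM => //.
by apply: measurableT_comp => //; exact: measurable_funB.
Qed.

Lemma gconv_dom k a b c B M phi x y : gaussian_family k ->
  (forall y, `|phi y| <= M) -> 0 < a -> a <= c <= b -> `|x| <= B ->
  `|phi y * k c (x - y)| <=
  M * ((b + 2) * expR (b * B ^+ 2)) * gker (a / 4) y.
Proof.
move=> [_ kb _] phiM a0 acb xB; have /andP[ac cb] := acb.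
rewrite normrM -!mulrA ler_pM//.
have c0 : 0 <= c by rewrite (le_trans (ltW a0)).
apply: (le_trans (kb _ (x - y) c0)); rewrite ler_pM ?gker_ge0 ?lerD2r//; first by rewrite addr_ge0.
exact: gker_dom xB.
Qed.

Lemma integrable_gconv k c M phi x : gaussian_family k ->
  measurable_fun [set: R] phi -> (forall y, `|phi y| <= M) -> 0 < c ->
  mu.-integrable [set: R] (EFin \o (fun y => phi y * k c (x - y))).
Proof.
move=> gk mphi phiM c0.
have c40 : 0 < c / 4 by rewrite divr_gt0.
pose C := M * ((c + 2) * expR (c * `|x| ^+ 2)).
have ig : mu.-integrable [set: R] (fun y => C%:E * (gker (c / 4) y)%:E)%E.
  by apply: integrableZl => //; exact: integrable_gker.
apply: (le_integrable measurableT _ _ ig) => //.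
- by apply/measurable_EFinP; exact: measurable_gconv_integrand.
- move=> y _; rewrite /= lee_fin.
  have cc : c <= c <= c by rewrite lexx.
  exact: le_trans (gconv_dom y gk phiM c0 cc (lexx _)) (ler_norm _).
Qed.

(** Dominated convergence with rate, centre and data varying together. Case 1 moves the rate, Case 2
    the data, and both move the centre. *)
Lemma cvg_gconv k (c_ x_ : R^nat) (phi_ : nat -> R -> R) c x phi M :
  gaussian_family k -> 0 < c ->
  c_ n @[n --> \oo] --> c -> x_ n @[n --> \oo] --> x ->
  (forall n, measurable_fun [set: R] (phi_ n)) ->
  measurable_fun [set: R] phi ->
  (forall n y, `|phi_ n y| <= M) ->
  (forall y, phi_ n y @[n --> \oo] --> phi y) ->
  gconv (k (c_ n)) (phi_ n) (x_ n) @[n --> \oo] --> gconv (k c) phi x.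
Proof.
move=> gk c0 cc xx mphi_ mphi phiM phiphi.
have c20 : 0 < c / 2 by rewrite divr_gt0.
(* Eventually the rates lie in [c/2, c + 1] and the centres within |x| + 1 of 0, the ranges used in
   the envelope. As domination must hold for every index, the sequence is shifted by N. *)
have [N _ NP] : \forall n \near \oo, c / 2 <= c_ n <= c + 1 /\ `|x_ n| <= `|x| + 1.
  near=> n; split.
    apply/andP; split; near: n.
      by apply: (cvgr_ge c) => //; lra.
    by apply: (cvgr_le c) => //; lra.
  near: n; apply: (cvgr_le `|x|); first exact: cvg_norm.
  by rewrite ltrDl.
pose C := M * ((c + 1 + 2) * expR ((c + 1) * (`|x| + 1) ^+ 2)).
have ig : mu.-integrable [set: R] (fun y => C%:E * (gker (c / 2 / 4) y)%:E)%E.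
  by apply: integrableZl => //; apply: integrable_gker; rewrite divr_gt0.
pose f_ n (y : R) : \bar R := (phi_ (n + N)%N y * k (c_ (n + N)%N) (x_ (n + N)%N - y))%:E.
have [||| |] := @dominated_convergence _ _ _ mu _ measurableT f_
  (fun y => (phi y * k c (x - y))%:E) _ _ _ _ ig.
- by move=> n; apply/measurable_EFinP; exact: measurable_gconv_integrand.
- by apply/measurable_EFinP; exact: measurable_gconv_integrand.
- apply: aeW => y _; apply: cvg_EFin; first exact: nearW.
  rewrite /comp/= (cvg_shiftn N (fun n => phi_ n y * k (c_ n) (x_ n - y))).
  have [_ _ kc] := gk; apply: cvgM => //; apply: kc => //.
  by apply: cvgB => //; exact: cvg_cst.
- apply: aeW => y n _; rewrite /= lee_fin.
  have [cn xn] := NP (n + N)%N (leq_addl _ _).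
  exact: gconv_dom.
move=> intf _ lim; rewrite -(cvg_shiftn N); apply: fine_cvg.
by rewrite fineK//; exact: integrable_fin_num.
Unshelve. all: end_near. Qed.

Lemma is_derive_gker c z : is_derive z 1 (gker c) (dgker c z).
Proof.
rewrite /gker; apply: is_derive_eq.
by rewrite /dgker /gker /GRing.scale/= !mulr1; ring.
Qed.

(** Differentiation under the integral sign: on ]x - 1, x + 1[ the partial derivative is dominated
    by [gconv_dom] for [dgker] with a = b = c and B = |x| + 1. *)
Lemma is_derive_gconv c phi x M : 0 < c ->
  measurable_fun [set: R] phi -> (forall y, `|phi y| <= M) ->
  is_derive x 1 (gconv (gker c) phi) (gconv (dgker c) phi x).
Proof.
move=> c0 mphi phiM; have [gk dgk] := (gaussian_family_gker, gaussian_family_dgker).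
pose f z y : R := phi y * gker c (z - y).
have df z y : is_derive z 1 (f ^~ y) (phi y * dgker c (z - y)).
  have dgk1 : is_derive z 1 (gker c \o shift (- y)) (dgker c (z - y) * 1).
    by apply: is_derive1_comp; [exact: is_derive_gker|exact: is_derive_shift].
  have -> : f ^~ y = phi y \*: (gker c \o shift (- y)) by [].
  by apply: is_derive_eq; rewrite mulr1.
have d1f z y : partial1of2 f z y = phi y * dgker c (z - y).
  by rewrite partial1of2E; exact: derive_val.
have xI : `]x - 1, x + 1[%classic x by rewrite /= in_itv/=; lra.
pose C := M * ((c + 2) * expR (c * (`|x| + 1) ^+ 2)).
have C0 : 0 <= C.
  rewrite mulr_ge0 ?(le_trans _ (phiM 0))// mulr_ge0 ?expR_ge0//; lra.
have intf z : `]x - 1, x + 1[%classic z -> mu.-integrable [set: R] (EFin \o f z).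
  by move=> _; exact: integrable_gconv phiM c0.
have derf z y : `]x - 1, x + 1[%classic z -> [set: R] y -> derivable (f ^~ y) z 1.
  by move=> _ _; have [] := df z y.
have D0 y : 0 <= C * gker (c / 4) y by rewrite mulr_ge0 ?gker_ge0.
have intD : mu.-integrable [set: R] (EFin \o (fun y => C * gker (c / 4) y)).
  have c40 : 0 < c / 4 by rewrite divr_gt0.
  have -> : EFin \o (fun y => C * gker (c / 4) y) = (fun y => C%:E * (gker (c / 4) y)%:E)%E.
    by apply/funext => y; rewrite /= EFinM.
  by apply: integrableZl => //; exact: integrable_gker.
have Dub z y : `]x - 1, x + 1[%classic z -> [set: R] y ->
    `|partial1of2 f z y| <= C * gker (c / 4) y.
  rewrite /= in_itv/= => /andP[xz zx] _; rewrite d1f.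
  have cc : c <= c <= c by rewrite lexx.
  apply: (gconv_dom _ dgk phiM c0 cc).
  rewrite -(subrK x z) (le_trans (ler_normD _ _))// addrC lerD2l ler_norml; lra.
apply: DeriveDef.
  exact: (derivable_under_integral measurableT xI intf derf D0 intD Dub).
rewrite -derive1E (differentiation_under_integral measurableT xI intf derf D0 intD Dub).
by apply: eq_Rintegral => y _; rewrite d1f.
Qed.

End gaussian_convolution.

(** * Affine change of variables in the Lebesgue integral *)

Section affine_substitution.
Context {R : realType}.
Implicit Types (a b : R).

Local Notation mu := (@lebesgue_measure R).

(** A negative slope exchanges the endpoints, so the preimage is then closed on the left instead of
    on the right. *)
Lemma preimage_affine_itvoc a b p q : a != 0 ->
  (fun y => a * y + b) @^-1` `]p, q]%classic =
  if 0 < a then `](p - b) / a, (q - b) / a]%classic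
  else `[(q - b) / a, (p - b) / a[%classic.
Proof.
move=> an0; case: ltrgtP (an0) => [a0 _|a0 _|]//.
- apply/funext => y; rewrite /= !in_itv/= ltr_pdivrMr// ler_pdivlMr//.
  by rewrite lerBrDr ltrBlDr mulrC.
- apply/funext => y; rewrite /= !in_itv/= ler_ndivrMr// ltr_ndivlMr//.
  by rewrite lerBrDr ltrBlDr mulrC andbC.
Qed.

Let measurable_affine a b :
  measurable_fun [set: measurableTypeR R] (fun y => a * y + b : measurableTypeR R).
Proof. by apply: measurable_funD => //; exact: measurable_funM. Qed.

(** The image of Lebesgue measure under the affine map, multiplied by |a|, gives every []p, q]] its
    length. By uniqueness it is Lebesgue measure, and the formula is integration against an image
    measure. *)
Lemma ge0_integral_affine a b (f : R -> \bar R) : a != 0 ->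
  measurable_fun [set: R] f -> (forall y, (0 <= f y)%E) ->
  (\int[mu]_y f y = `|a|%:E * \int[mu]_y f (a * y + b)%R)%E.
Proof.
move=> a0 mf f0.
rewrite -[X in (_ * X)%E]/(integral mu ((fun y => a * y + b) @^-1` setT)
  (f \o (fun y => a * y + b))).
rewrite -(ge0_integral_pushforward (measurable_affine a b) mu measurableT mf); last by [].
rewrite -[`|a|]/((NngNum (normr_ge0 a))%:num) -ge0_integral_mscale//.
apply: eq_measure_integral => A mA _; apply: lebesgue_measure_unique => // _ [[p q]] _ <-.
pose F : set R := if 0 < a then `](p - b) / a, (q - b) / a]%classic
  else `[(q - b) / a, (p - b) / a[%classic.
transitivity (`|a|%:E * mu F)%E; last by rewrite /F -(preimage_affine_itvoc b p q a0).
rewrite /F {F}.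
rewrite lebesgue_measure_itv; case: ltrgtP (a0) => [ap _|an _|//].
- rewrite lebesgue_measure_itv/= !lte_fin ltr_pM2r ?invr_gt0// ltrD2r.
  case: ifPn => _; last by rewrite mule0.
  rewrite -!EFinD -EFinM gtr0_norm//; congr _%:E; field; exact: a0.
- rewrite lebesgue_measure_itv/= !lte_fin ltr_nM2r ?invr_lt0// ltrD2r.
  case: ifPn => _; last by rewrite mule0.
  rewrite -!EFinD -EFinM ltr0_norm//; congr _%:E; field; exact: a0.
Qed.

(** The nonnegative case applied to the positive and negative parts; integrability allows |a| to be
    distributed over their difference. *)
Lemma Rintegral_affine a b (f : R -> R) : a != 0 ->
  measurable_fun [set: R] f ->
  mu.-integrable [set: R] (EFin \o (fun y => f (a * y + b))) ->
  \int[mu]_y f y = `|a| * \int[mu]_y f (a * y + b).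
Proof.
move=> a0 mf intf; rewrite /Rintegral.
suff -> : (\int[mu]_y (f y)%:E = `|a|%:E * \int[mu]_y (f (a * y + b))%:E)%E.
  by rewrite fineM//; exact: integrable_fin_num.
rewrite integralE [X in (_ * X)%E]integralE muleBr//; last exact: integrable_add_def.
have mF : measurable_fun [set: R] (EFin \o f) by apply/measurable_EFinP.
rewrite (ge0_integral_affine b a0 (measurable_funepos mF)) //.
rewrite (ge0_integral_affine b a0 (measurable_funeneg mF)) //.
by congr (_ * _ - _ * _)%E; apply: eq_integral => y _; rewrite ?funeposE ?funenegE.
Qed.

End affine_substitution.

(** * Positivity, rescaling and step data *)

Section gaussian_convolution_values.
Context {R : realType}.
Implicit Types (c s x xi M : R) (phi : R -> R).

Local Notation mu := (@lebesgue_measure R).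

(** The convolution is at least m times the total mass of the Gaussian, which is the inverse of the
    normal peak. *)
Lemma gconv_gt0 c phi x m M : 0 < c ->
  measurable_fun [set: R] phi -> (forall y, `|phi y| <= M) ->
  0 < m -> (forall y, m <= phi y) -> 0 < gconv (gker c) phi x.
Proof.
move=> c0 mphi phiM m0 mp; pose s := Num.sqrt ((2 * c)^-1).
have s0 : s != 0 by rewrite gt_eqF// sqrtr_gt0 invr_gt0 mulr_gt0.
have C0 : 0 < m * (normal_peak s)^-1 by rewrite mulr_gt0// invr_gt0 normal_peak_gt0.
have pdf1 : \int[mu]_y normal_pdf x s y = 1 by rewrite /Rintegral integral_normal_pdf.
rewrite (lt_le_trans C0)// -[leLHS]mulr1 -pdf1 -RintegralZl//; last first.
  exact: integrable_normal_pdf.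
apply: le_Rintegral => //.
- exact: (integrableZl measurableT _ (integrable_normal_pdf x s)).
- by apply: integrable_gconv phiM c0 => //; exact: gaussian_family_gker.
- move=> y _; rewrite -mulrA -gker_normal_pdf//.
  have -> : gker c (x - y) = gker c (y - x) by rewrite /gker -sqrrN opprB.
  by rewrite ler_pM2r ?gker_gt0.
Qed.

Lemma gker_scale c s z : gker c (s * z) = gker (c * s ^+ 2) z.
Proof. by congr expR; rewrite exprMn mulrA. Qed.

Lemma dgker_scale c s z : s * dgker c (s * z) = dgker (c * s ^+ 2) z.
Proof. by rewrite /dgker gker_scale; ring. Qed.

(** The substitution y = s y'. The factor d covers both kernels: it is s for [gker] and 1 for
    [dgker], whose linear factor absorbs the Jacobian. *)
Lemma gconv_scale k c d s xi phi M : gaussian_family k -> 0 < c -> 0 < s ->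
  (forall z, s * k c (s * z) = d * k (c * s ^+ 2) z) ->
  measurable_fun [set: R] phi -> (forall y, `|phi y| <= M) ->
  gconv (k c) phi (s * xi) = d * gconv (k (c * s ^+ 2)) (fun y => phi (s * y)) xi.
Proof.
move=> gk c0 s0 ks mphi phiM.
have ms : measurable_fun [set: R] (fun y => phi (s * y)) by exact: measurableT_comp.
have cs0 : 0 < c * s ^+ 2 by rewrite mulr_gt0// exprn_gt0.
have ik := integrable_gconv xi gk ms (fun y => phiM (s * y)) cs0.
have ksE y : phi (s * y + 0) * k c (s * xi - (s * y + 0)) =
             d / s * (phi (s * y) * k (c * s ^+ 2) (xi - y)).
  by rewrite addr0 -mulrBr mulrCA mulrAC -ks; field; rewrite gt_eqF.
rewrite /gconv (@Rintegral_affine _ s 0) ?gt_eqF//; last 2 first.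
- exact: measurable_gconv_integrand.
- rewrite (_ : EFin \o _ = fun y => ((d / s)%:E * (phi (s * y) * k (c * s ^+ 2) (xi - y))%:E)%E).
    by apply: integrableZl.
  by apply/funext => y; rewrite /= ksE.
under eq_Rintegral do rewrite ksE.
by rewrite RintegralZl// gtr0_norm// mulrA mulrCA divff ?mulr1// gt_eqF.
Qed.

(** The reflection y -> xi - y turns the sign of the argument into the position of y relative to xi,
    so the integral splits there into the two Gaussian tails. *)
Lemma gconv_step (a b d xi : R) :
  gconv (gker 2^-1) (fun y => if 0 < y then a else if y < 0 then b else d) xi =
  a * gauss_left xi + b * gauss_right xi.
Proof.
pose phi := fun y : R => if 0 < y then a else if y < 0 then b else d.
have ig : mu.-integrable [set: R] (EFin \o gker 2^-1) by exact: integrable_gker.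
have gE (y : R) : expR (- (y ^+ 2 / 2)) = gker 2^-1 y by rewrite /gker mulrC.
have phiM y : `|phi y| <= `|a| + `|b| + `|d|.
  have := normr_ge0 a; have := normr_ge0 b; have := normr_ge0 d.
  by rewrite /phi; case: ifPn => _; [|case: ifPn => _]; lra.
have mphi : measurable_fun [set: R] phi.
  apply: measurable_fun_ifT => //.
    exact: measurable_fun_ltr.
  apply: measurable_fun_ifT => //.
  exact: measurable_fun_ltr.
have gk := @gaussian_family_gker R.
(* Integrability after reflection: a convolution with data phi (xi - y) centred at 0, the kernel
   being even. *)
have ip : mu.-integrable [set: R] (EFin \o (fun y => phi (xi - y) * gker 2^-1 (0 - y))).
  apply: (integrable_gconv 0 gk _ (fun y => phiM (xi - y))) => //.
  by apply: measurableT_comp => //; exact: measurable_funB.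
have {}ip : mu.-integrable [set: R] (EFin \o (fun y => phi (xi - y) * gker 2^-1 y)).
  by congr (mu.-integrable _ _) : ip; apply/funext => y; rewrite /= /gker sub0r sqrrN.
rewrite /gconv (@Rintegral_affine _ (-1) xi) ?oppr_eq0//; last 2 first.
- exact: measurable_gconv_integrand.
- by congr (mu.-integrable _ _) : ip; apply/funext => y; rewrite /= mulN1r [- _ + _]addrC subKr.
rewrite normrN normr1 mul1r.
under eq_Rintegral do rewrite mulN1r [- _ + _]addrC subKr.
have EFin_int (D : set R) : measurable D ->
    mu.-integrable D (EFin \o (fun y => phi (xi - y) * gker 2^-1 y)).
  by move=> mD; exact: (integrableS measurableT).
have gint (D : set R) : measurable D -> mu.-integrable D (EFin \o gker 2^-1).
  by move=> mD; exact: (integrableS measurableT).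
have := @Rintegral_itvB R (fun y => phi (xi - y) * gker 2^-1 y) -oo%O +oo%O xi.
rewrite set_itvNyy => /(_ ip isT isT)/eqP; rewrite subr_eq => /eqP ->.
(* The point y = xi, where the reflected step takes the value d, is a null set and is dropped. *)
rewrite -Rintegral_itv_bndo_bndc; last exact: EFin_int.
rewrite addrC; congr (_ + _).
  have -> : gauss_left xi = \int[mu]_(y in `]-oo, xi]) gker 2^-1 y.
    by apply: eq_Rintegral => y _; exact: gE.
  rewrite -Rintegral_itv_bndo_bndc; last exact: gint.
  rewrite -RintegralZl//; last exact: gint.
  apply: eq_Rintegral => y; rewrite inE/= in_itv/= => yxi.
  by rewrite /phi subr_gt0 yxi.
have -> : gauss_right xi = \int[mu]_(y in `[xi, +oo[) gker 2^-1 y.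
  by apply: eq_Rintegral => y _; exact: gE.
rewrite -Rintegral_itv_obnd_cbnd; last exact: gint.
rewrite -RintegralZl//; last exact: gint.
apply: eq_Rintegral => y; rewrite inE/= in_itv/= andbT => xiy.
by rewrite /phi subr_gt0 ltNge (ltW xiy)/= subr_lt0 xiy.
Qed.

End gaussian_convolution_values.

(** * Continuity, bounds and limits at infinity of the primitives *)

Section primitive.
Context {R : realType}.
Implicit Types (f : R -> R) (y : R).

Local Notation mu := (@lebesgue_measure R).

(** Dominated convergence for the restrictions of f, with envelope |f|. The exceptional point p
    allows for a moving endpoint, at whose limit membership may oscillate. *)
Lemma cvg_Rintegral_set f (D_ : (set R)^nat) (D : set R) (p : R) :
  mu.-integrable [set: R] (EFin \o f) ->
  (forall n, measurable (D_ n)) -> measurable D ->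
  (forall y, y != p -> \forall n \near \oo, D_ n y <-> D y) ->
  \int[mu]_(y in D_ n) f y @[n --> \oo] --> \int[mu]_(y in D) f y.
Proof.
move=> intf mD_ mD D_D.
have mf : measurable_fun [set: R] f by apply/measurable_EFinP; exact: measurable_int intf.
have mfr (E : set R) : measurable E -> measurable_fun [set: R] (EFin \o (f \_ E)).
  move=> mE; apply/measurable_EFinP; apply/(measurable_restrictT _ mE).
  exact: measurable_funS mf.
have intN : mu.-integrable [set: R] (EFin \o (fun y => `|f y|)) by exact: integrable_norm.
have [||| |] := @dominated_convergence _ _ _ mu _ measurableT
  (fun n => EFin \o (f \_ (D_ n))) (EFin \o (f \_ D)) _ _ _ _ intN.
- by move=> n; exact: mfr.
- exact: mfr.
- exists [set p]; split; [exact: measurable_set1|exact: lebesgue_measure_set1|].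
  move=> y /=; apply: contra_notP => /eqP yp _.
  apply: cvg_EFin; first exact: nearW.
  apply: cvg_near_cst; have := D_D _ yp; apply: filterS => n [DnD DDn].
  rewrite /comp/= !patchE; congr (if _ then _ else _).
  by apply/idP/idP; rewrite !inE.
- apply: aeW => y n _; rewrite /= lee_fin patchE.
  by case: ifPn => _; rewrite ?normr0.
move=> intfD _ lim.
under eq_cvg do rewrite Rintegral_mkcond.
rewrite Rintegral_mkcond; apply: fine_cvg; rewrite fineK//.
exact: integrable_fin_num.
Qed.

(** One formula for both signs of y: continuity and the limits at infinity reduce to a half-line
    with a moving endpoint. *)
Lemma primitive0E f y : mu.-integrable [set: R] (EFin \o f) ->
  primitive0 f y = \int[mu]_(s in `]-oo, y]) f s - \int[mu]_(s in `]-oo, 0]) f s.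
Proof.
move=> intf; have iS (D : set R) : measurable D -> mu.-integrable D (EFin \o f).
  by move=> mD; exact: (integrableS measurableT).
rewrite /primitive0; case: ifPn => y0.
  rewrite Rintegral_itvB ?bnd_simp//; last exact: iS.
  by rewrite Rintegral_itv_obnd_cbnd//; exact: iS.
rewrite -ltNge in y0; rewrite -[RHS]opprB; congr (- _).
rewrite Rintegral_itvB ?bnd_simp ?(ltW y0)//; last exact: iS.
by rewrite Rintegral_itv_obnd_cbnd//; exact: iS.
Qed.

Lemma normr_primitive0 f y : mu.-integrable [set: R] (EFin \o f) ->
  `|primitive0 f y| <= \int[mu]_s `|f s|.
Proof.
move=> intf.
have intN : mu.-integrable [set: R] (EFin \o (fun y => `|f y|)) by exact: integrable_norm.
have bound (D : set R) : measurable D -> `|\int[mu]_(s in D) f s| <= \int[mu]_s `|f s|.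
  move=> mD; apply: le_trans.
    by apply: le_normr_Rintegral => //; exact: (integrableS measurableT).
  rewrite Rintegral_mkcond; apply: le_Rintegral => //.
    have iD : mu.-integrable D (EFin \o (fun s => `|f s|)) by exact: (integrableS measurableT).
    by move/(@integrable_mkcond _ _ _ mu D _ mD) : iD; rewrite restrict_EFin.
  move=> s _; rewrite patchE; case: ifPn => _ //; exact: normr_ge0.
by rewrite /primitive0; case: ifPn => _; rewrite ?normrN bound.
Qed.

Lemma cvg_primitive0 f y (y_ : R^nat) : mu.-integrable [set: R] (EFin \o f) ->
  y_ n @[n --> \oo] --> y -> primitive0 f (y_ n) @[n --> \oo] --> primitive0 f y.
Proof.
move=> intf yy; rewrite primitive0E//; under eq_cvg do rewrite primitive0E//.
apply: cvgB; last exact: cvg_cst.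
apply: (@cvg_Rintegral_set f (fun n => `]-oo, y_ n]%classic) _ y) => // s.
case: ltgtP => // [sy|ys] _; near=> n; rewrite /= !in_itv/=.
  by rewrite (ltW sy); split => // _; near: n; apply: (cvgr_ge y).
have yns : y_ n < s by near: n; exact: (cvgr_lt y).
by rewrite !leNgt ys yns.
Unshelve. all: end_near. Qed.

Lemma measurable_primitive0 f : mu.-integrable [set: R] (EFin \o f) ->
  measurable_fun [set: R] (primitive0 f).
Proof.
move=> intf; apply: continuous_measurable_fun => y.
by apply/(@cvg_nbhsP _ R^o) => y_; exact: cvg_primitive0.
Qed.

(** Since [primitive0_pinfty] is a [lim], convergence to any value suffices. The half-lines
    eventually contain each point, so their integrals tend to that over the whole line. *)
Lemma cvg_primitive0_pinfty f : mu.-integrable [set: R] (EFin \o f) ->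
  primitive0 f y @[y --> +oo] --> primitive0_pinfty f.
Proof.
move=> intf; rewrite /primitive0_pinfty; apply/cvg_ex.
exists (\int[mu]_s f s - \int[mu]_(s in `]-oo, 0]) f s).
apply/cvg_pinftyP => u uoo; under eq_cvg do rewrite primitive0E//.
apply: cvgB; last exact: cvg_cst.
apply: (@cvg_Rintegral_set f (fun n => `]-oo, u n]%classic) _ 0) => // s _.
near=> n; rewrite /= in_itv/=; split => // _.
by near: n; exact: cvgry_ge.
Unshelve. all: end_near. Qed.

Lemma cvg_primitive0_ninfty f : mu.-integrable [set: R] (EFin \o f) ->
  primitive0 f y @[y --> -oo] --> primitive0_ninfty f.
Proof.
move=> intf; rewrite /primitive0_ninfty; apply/cvg_ex.
(* Towards -oo the half-lines eventually omit each point, hence the empty set. *)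
exists (\int[mu]_(s in set0) f s - \int[mu]_(s in `]-oo, 0]) f s).
apply/cvg_ninftyP => u uoo; under eq_cvg do rewrite primitive0E//.
apply: cvgB; last exact: cvg_cst.
apply: (@cvg_Rintegral_set f (fun n => `]-oo, u n]%classic) _ 0) => // s _.
near=> n; rewrite /= in_itv/=; split => //; apply/negP; rewrite -ltNge.
by near: n; exact: cvgrNy_lt.
Unshelve. all: end_near. Qed.

End primitive.

(** * Quotients of Gaussian convolutions: derivatives, limits and scaling *)

Section convolution_quotient.
Context {R : realType}.
Implicit Types (c s x xi m M : R) (phi psi : R -> R).

(** The logarithmic derivative N'/N, where N is the Gaussian convolution of [phi]. *)
Definition dlog_gconv c phi x := gconv (dgker c) phi x / gconv (gker c) phi x.

(** The quotient rule for (E/N)' written through convolutions only, so that limits need no exchange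
    with a derivative. *)
Definition dquot_gconv c phi psi x :=
  (gconv (dgker c) psi x * gconv (gker c) phi x -
   gconv (gker c) psi x * gconv (dgker c) phi x) / gconv (gker c) phi x ^+ 2.

Lemma derive1_gconv c phi M x : 0 < c ->
  measurable_fun [set: R] phi -> (forall y, `|phi y| <= M) ->
  derive1 (gconv (gker c) phi) x = gconv (dgker c) phi x.
Proof.
move=> c0 mphi phiM; rewrite derive1E.
by have dN := is_derive_gconv x c0 mphi phiM; rewrite derive_val.
Qed.

Lemma bounded_normr phi m M : 0 < m -> (forall y, m <= phi y <= M) ->
  forall y, `|phi y| <= M.
Proof.
by move=> m0 mM y; have /andP[my yM] := mM y; rewrite ger0_norm// (le_trans (ltW m0)).
Qed.

Lemma gconv_pos_neq0 c phi m M x : 0 < c -> measurable_fun [set: R] phi ->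
  0 < m -> (forall y, m <= phi y <= M) -> gconv (gker c) phi x != 0.
Proof.
move=> c0 mphi m0 mM; rewrite gt_eqF//.
apply: (gconv_gt0 x c0 mphi (bounded_normr m0 mM) m0).
by move=> y; have /andP[] := mM y.
Qed.

Lemma derive1_quot_gconv c phi psi m M M' x : 0 < c ->
  measurable_fun [set: R] phi -> measurable_fun [set: R] psi ->
  0 < m -> (forall y, m <= phi y <= M) -> (forall y, `|psi y| <= M') ->
  derive1 (fun z => gconv (gker c) psi z / gconv (gker c) phi z) x =
  dquot_gconv c phi psi x.
Proof.
move=> c0 mphi mpsi m0 mM psiM; rewrite derive1E.
have phiM := bounded_normr m0 mM.
have N0 := gconv_pos_neq0 x c0 mphi m0 mM.
have dE := is_derive_gconv x c0 mpsi psiM.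
have dN := is_derive_gconv x c0 mphi phiM.
have dV := is_deriveV N0 dN.
have dQ := is_deriveM dE dV.
rewrite (@derive_val _ _ _ _ _ _ _ dQ) /dquot_gconv /GRing.scale/=.
by field.
Qed.

Lemma cvg_bounds (f_ : R^nat) (l m M : R) : (forall n, m <= f_ n <= M) ->
  f_ n @[n --> \oo] --> l -> m <= l <= M.
Proof.
move=> mM fl; apply/andP; split.
- by apply: (cvgr_to_ge fl); apply: nearW => n; have /andP[] := mM n.
- by apply: (cvgr_to_le fl); apply: nearW => n; have /andP[] := mM n.
Qed.

Section limits.
Variables (c_ x_ : R^nat) (phi_ psi_ : nat -> R -> R).
Variables (c x m M M' : R) (phi psi : R -> R).
Hypotheses (c0 : 0 < c) (cc : c_ n @[n --> \oo] --> c) (xx : x_ n @[n --> \oo] --> x).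
Hypotheses (mphi_ : forall n, measurable_fun [set: R] (phi_ n))
  (mpsi_ : forall n, measurable_fun [set: R] (psi_ n)).
Hypotheses (mphi : measurable_fun [set: R] phi) (mpsi : measurable_fun [set: R] psi).
Hypotheses (m0 : 0 < m) (mM : forall n y, m <= phi_ n y <= M)
  (psiM : forall n y, `|psi_ n y| <= M').
Hypotheses (phiphi : forall y, phi_ n y @[n --> \oo] --> phi y)
  (psipsi : forall y, psi_ n y @[n --> \oo] --> psi y).

(** The lower bound m > 0 survives the pointwise limit, so the limiting denominator is positive. *)
Let N0 : gconv (gker c) phi x != 0.
Proof.
apply: (@gconv_pos_neq0 c phi m M) => // y.
exact: (cvg_bounds (fun n => mM n y) (@phiphi y)).
Qed.

Let phiM n : forall y, `|phi_ n y| <= M := bounded_normr m0 (mM n).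

Lemma cvg_dlog_gconv :
  dlog_gconv (c_ n) (phi_ n) (x_ n) @[n --> \oo] --> dlog_gconv c phi x.
Proof.
apply: cvgM; last apply: cvgV => //; apply: cvg_gconv => //.
- exact: gaussian_family_dgker.
- exact: gaussian_family_gker.
Qed.

Lemma cvg_dquot_gconv :
  dquot_gconv (c_ n) (phi_ n) (psi_ n) (x_ n) @[n --> \oo] --> dquot_gconv c phi psi x.
Proof.
have gk := @gaussian_family_gker R; have dgk := @gaussian_family_dgker R.
have cN : gconv (gker (c_ n)) (phi_ n) (x_ n) @[n --> \oo] --> gconv (gker c) phi x.
  by apply: (cvg_gconv gk).
have cE : gconv (gker (c_ n)) (psi_ n) (x_ n) @[n --> \oo] --> gconv (gker c) psi x.
  by apply: (cvg_gconv gk).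
apply: cvgM; last by apply: cvgV; rewrite ?expf_neq0// !expr2; exact: cvgM.
apply: cvgB; apply: cvgM => //.
- by apply: (cvg_gconv dgk).
- by apply: (cvg_gconv dgk).
Qed.

End limits.

Section scaling.
Variables (c s : R) (phi psi : R -> R) (m M M' : R).
Hypotheses (c0 : 0 < c) (s0 : 0 < s).
Hypotheses (mphi : measurable_fun [set: R] phi) (mpsi : measurable_fun [set: R] psi).
Hypotheses (m0 : 0 < m) (mM : forall y, m <= phi y <= M)
  (psiM : forall y, `|psi y| <= M').

Let gconv_gker_scale (f : R -> R) (A xi : R) :
  measurable_fun [set: R] f -> (forall y, `|f y| <= A) ->
  gconv (gker c) f (s * xi) = s * gconv (gker (c * s ^+ 2)) (fun y => f (s * y)) xi.
Proof.
move=> mf fA; apply: gconv_scale mf fA => //; first exact: gaussian_family_gker.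
by move=> z; rewrite gker_scale.
Qed.

Let gconv_dgker_scale (f : R -> R) (A xi : R) :
  measurable_fun [set: R] f -> (forall y, `|f y| <= A) ->
  gconv (dgker c) f (s * xi) = gconv (dgker (c * s ^+ 2)) (fun y => f (s * y)) xi.
Proof.
move=> mf fA; rewrite -[RHS]mul1r; apply: gconv_scale mf fA => //.
  exact: gaussian_family_dgker.
by move=> z; rewrite dgker_scale mul1r.
Qed.

Let N0 xi : gconv (gker (c * s ^+ 2)) (fun y => phi (s * y)) xi != 0.
Proof.
apply: (@gconv_pos_neq0 _ _ m M) => //; first by rewrite mulr_gt0// exprn_gt0.
exact: measurableT_comp.
Qed.

(** Under x = s xi the convolution with [gker] gains a factor s while that with [dgker] gains none;
    the outer s restores the balance. *)
Lemma dlog_gconv_scale xi :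
  s * dlog_gconv c phi (s * xi) = dlog_gconv (c * s ^+ 2) (fun y => phi (s * y)) xi.
Proof.
have phiM := bounded_normr m0 mM.
rewrite /dlog_gconv (gconv_gker_scale _ mphi phiM) (gconv_dgker_scale _ mphi phiM).
by field; rewrite N0 gt_eqF.
Qed.

Lemma dquot_gconv_scale xi :
  s * dquot_gconv c phi psi (s * xi) =
  dquot_gconv (c * s ^+ 2) (fun y => phi (s * y)) (fun y => psi (s * y)) xi.
Proof.
have phiM := bounded_normr m0 mM.
rewrite /dquot_gconv !(gconv_gker_scale _ mphi phiM) !(gconv_dgker_scale _ mphi phiM).
rewrite !(gconv_gker_scale _ mpsi psiM) !(gconv_dgker_scale _ mpsi psiM).
by field; rewrite N0 gt_eqF.
Qed.

End scaling.

End convolution_quotient.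

(** * The explicit solution as quotients of Gaussian convolutions *)

Section hopf_cole.
Context {R : realType}.
Implicit Types (alpha eps s t x y xi : R) (u v : R -> R).

Local Notation mu := (@lebesgue_measure R).

Definition hopf_cole eps u y := expR (- (primitive0 u y / (2 * eps))).

Definition hopf_cole_V eps u v y := primitive0 v y * hopf_cole eps u y.

(* The value at 0 is that of every rescaling y |-> f (s * y), of which
   blowdown is the pointwise limit as s tends to +oo. *)
Definition blowdown (f : R -> R) a b y := if 0 < y then a else if y < 0 then b else f 0.

Lemma measurable_blowdown f a b : measurable_fun [set: R] (blowdown f a b).
Proof.
apply: measurable_fun_ifT => //; first exact: measurable_fun_ltr.
by apply: measurable_fun_ifT => //; exact: measurable_fun_ltr.
Qed.

Lemma cvg_blowdown (f : R -> R) a b (s_ : R^nat) y :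
  s_ n @[n --> \oo] --> +oo -> f z @[z --> +oo] --> a -> f z @[z --> -oo] --> b ->
  f (s_ n * y) @[n --> \oo] --> blowdown f a b y.
Proof.
move=> soo fa fb; rewrite /blowdown; case: ltrgtP => [y0|y0|<-].
- have sy : s_ n * y @[n --> \oo] --> +oo by exact: cvg_comp soo (gt0_cvgMly y0 cvg_id).
  exact: (cvg_comp _ _ sy fa).
- have sy : s_ n * y @[n --> \oo] --> -oo.
    apply/cvgNry; have -> : - (fun n => s_ n * y) = *%R^~ (- y) \o s_.
      by apply/funext => n /=; rewrite mulrN.
    by apply: cvg_comp soo _; apply: (gt0_cvgMly _ cvg_id); rewrite oppr_gt0.
  exact: (cvg_comp _ _ sy fb).
- by under eq_cvg do rewrite mulr0; exact: cvg_cst.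
Qed.

Definition hopf_cole_oo eps u := blowdown (hopf_cole eps u)
  (expR (- (primitive0_pinfty u / (2 * eps))))
  (expR (- (primitive0_ninfty u / (2 * eps)))).

Definition hopf_cole_V_oo eps u v := blowdown (hopf_cole_V eps u v)
  (primitive0_pinfty v * expR (- (primitive0_pinfty u / (2 * eps))))
  (primitive0_ninfty v * expR (- (primitive0_ninfty u / (2 * eps)))).

Lemma tau_gt0 alpha t : alpha != 0 -> 0 < t -> 0 < tau alpha t.
Proof.
move=> a0 t0; rewrite /tau; case: (ltrgtP alpha 0) (a0) => // [an|ap] _; last first.
- by rewrite divr_gt0// subr_gt0 expR_lt1 mulNr oppr_lt0 mulr_gt0.
- by rewrite -mulrNN -invrN mulr_gt0 ?invr_gt0 ?oppr_gt0// subr_lt0 expR_gt1 mulr_gt0 ?oppr_gt0.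
Qed.

Lemma cvg_tau_gt0 alpha (t_ : R^nat) : 0 < alpha -> t_ n @[n --> \oo] --> +oo ->
  tau alpha (t_ n) @[n --> \oo] --> 1 / alpha.
Proof.
move=> a0 too; apply: cvgM; last exact: cvg_cst.
have atoo : alpha * t_ n @[n --> \oo] --> +oo.
  exact: cvg_comp too (gt0_cvgMry a0 cvg_id).
have e0 : expR (- alpha * t_ n) @[n --> \oo] --> 0.
  have -> : (fun n => expR (- alpha * t_ n)) = (fun z => expR (- z)) \o (fun n => alpha * t_ n).
    by apply/funext => n /=; rewrite mulNr.
  by apply: cvg_comp atoo _; exact: cvgr_expR.
by have := cvgB (cvg_cst (1 : R)) e0; rewrite subr0; apply; exact: eventually_filter.
Qed.

(** For alpha < 0, exp z >= 1 + z at z = - alpha t gives tau(t) >= t. *)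
Lemma cvg_tau_lt0 alpha (t_ : R^nat) : alpha < 0 -> t_ n @[n --> \oo] --> +oo ->
  tau alpha (t_ n) @[n --> \oo] --> +oo.
Proof.
move=> a0 too; apply/cvgryPge => A.
near=> n.
have an : 0 < - alpha by rewrite oppr_gt0.
have tn : A <= t_ n by near: n; exact: cvgry_ge.
rewrite (le_trans tn)// /tau -mulrNN -invrN ler_pdivlMr// opprB.
by have := expR_ge1Dx (- alpha * t_ n); lra.
Unshelve. all: end_near. Qed.

Section explicit_formulas.
Variables (eps : R) (u0 v0 : R -> R).
Hypothesis eps0 : 0 < eps.
Hypotheses (iu0 : mu.-integrable [set: R] (EFin \o u0))
  (iv0 : mu.-integrable [set: R] (EFin \o v0)).

Local Notation phi := (hopf_cole eps u0).
Local Notation psi := (hopf_cole_V eps u0 v0).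
Local Notation m := (expR (- (\int[mu]_s `|u0 s| / (2 * eps)))).
Local Notation M := (expR (\int[mu]_s `|u0 s| / (2 * eps))).
Local Notation M' := ((\int[mu]_s `|v0 s|) * M).
Local Notation rate s := ((4 * eps * s)^-1).

Lemma measurable_hopf_cole : measurable_fun [set: R] phi.
Proof.
apply: measurableT_comp => //; apply: measurableT_comp => //.
by apply: measurable_funM => //; exact: measurable_primitive0.
Qed.

Lemma measurable_hopf_cole_V : measurable_fun [set: R] psi.
Proof.
apply: measurable_funM; first exact: measurable_primitive0.
exact: measurable_hopf_cole.
Qed.

(** The primitive of [u0] is bounded by the L1 norm. The resulting positive lower bound keeps all
    denominators away from zero. *)
Lemma hopf_cole_bounds y : m <= phi y <= M.
Proof.
have := normr_primitive0 y iu0; rewrite ler_norml => /andP[lo up].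
have e2 : 0 < (2 * eps)^-1 by rewrite invr_gt0 mulr_gt0.
by rewrite !ler_expR lerN2 -mulNr !ler_pM2r// up lerNl lo.
Qed.

Lemma normr_hopf_cole_V y : `|psi y| <= M'.
Proof.
have /andP[_ yM] := hopf_cole_bounds y.
rewrite normrM ler_pM//; first exact: normr_primitive0.
by rewrite ger0_norm// expR_ge0.
Qed.

Lemma rate_gt0 s : 0 < s -> 0 < rate s.
Proof. by move=> s0; rewrite invr_gt0 !mulr_gt0. Qed.

Lemma weightE x y s : 0 < s -> weight eps u0 x y s = phi y * gker (rate s) (x - y).
Proof.
move=> s0; rewrite /weight /theta /hopf_cole /gker -expRD; congr expR.
by field; rewrite !gt_eqF.
Qed.

Lemma integral_weight x s : 0 < s ->
  \int[mu]_y weight eps u0 x y s = gconv (gker (rate s)) phi x.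
Proof. by move=> s0; apply: eq_Rintegral => y _; exact: weightE. Qed.

Lemma integral_V_weight x s : 0 < s ->
  \int[mu]_y (primitive0 v0 y * weight eps u0 x y s) = gconv (gker (rate s)) psi x.
Proof. by move=> s0; apply: eq_Rintegral => y _; rewrite weightE// mulrA. Qed.

(** At rate 1/(4 eps tau) the kernel times (x - y)/tau is exactly - 2 eps times [dgker]. *)
Lemma u_epsE alpha x t : 0 < tau alpha t ->
  u_eps alpha eps u0 x t =
  expR (- alpha * t) * (- (2 * eps) * dlog_gconv (rate (tau alpha t)) phi x).
Proof.
move=> t0; rewrite /u_eps integral_weight//; congr (_ * _).
rewrite /dlog_gconv [RHS]mulrA; congr (_ / _).
rewrite -RintegralZl//; last first.
  apply: (integrable_gconv x _ measurable_hopf_cole _ (rate_gt0 t0)).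
    exact: gaussian_family_dgker.
  exact: bounded_normr (expR_gt0 _) hopf_cole_bounds.
apply: eq_Rintegral => y _; rewrite weightE// /dgker.
by field; rewrite !gt_eqF.
Qed.

Lemma derive1_V_quot s x : 0 < s ->
  derive1 (fun z => gconv (gker (rate s)) psi z / gconv (gker (rate s)) phi z) x =
  dquot_gconv (rate s) phi psi x.
Proof.
move=> s0; apply: derive1_quot_gconv (rate_gt0 s0) _ _ _ hopf_cole_bounds normr_hopf_cole_V.
- exact: measurable_hopf_cole.
- exact: measurable_hopf_cole_V.
- exact: expR_gt0.
Qed.

Lemma v_epsE alpha x t : 0 < tau alpha t ->
  v_eps alpha eps u0 v0 x t = dquot_gconv (rate (tau alpha t)) phi psi x.
Proof.
move=> t0; rewrite -derive1_V_quot// /v_eps; congr (derive1 _ x).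
by apply/funext => z; rewrite /V_eps integral_weight// integral_V_weight.
Qed.

Lemma GE alpha : 0 < alpha -> G alpha eps u0 = gconv (gker (rate (1 / alpha))) phi.
Proof. by move=> a0; apply/funext => x; apply: integral_weight; rewrite divr_gt0. Qed.

Lemma HE alpha : 0 < alpha -> H alpha eps u0 v0 = gconv (gker (rate (1 / alpha))) psi.
Proof. by move=> a0; apply/funext => x; apply: integral_V_weight; rewrite divr_gt0. Qed.

Local Notation phi_oo := (hopf_cole_oo eps u0).
Local Notation psi_oo := (hopf_cole_V_oo eps u0 v0).

Lemma G_infE : G_inf eps u0 = gconv (gker 2^-1) phi_oo.
Proof. by apply/funext => xi; rewrite gconv_step. Qed.

Lemma H_infE : H_inf eps u0 v0 = gconv (gker 2^-1) psi_oo.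
Proof.
by apply/funext => xi; rewrite gconv_step /H_inf; congr (_ * _ + _ * _); exact: mulrC.
Qed.

Lemma cvg_hopf_cole (F : set_system R) (l : R) : Filter F ->
  primitive0 u0 y @[y --> F] --> l -> phi y @[y --> F] --> expR (- (l / (2 * eps))).
Proof.
move=> FF ul.
have ul' : - (primitive0 u0 y / (2 * eps)) @[y --> F] --> - (l / (2 * eps)).
  by apply: cvgN; apply: cvgM => //; exact: cvg_cst.
apply: (cvg_comp (fun y => - (primitive0 u0 y / (2 * eps))) expR ul').
exact: continuous_expR.
Qed.

Lemma cvg_phi_oo (s_ : R^nat) y : s_ n @[n --> \oo] --> +oo ->
  phi (s_ n * y) @[n --> \oo] --> phi_oo y.
Proof.
move=> soo; apply: cvg_blowdown => //; apply: cvg_hopf_cole.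
- exact: cvg_primitive0_pinfty.
- exact: cvg_primitive0_ninfty.
Qed.

Lemma cvg_psi_oo (s_ : R^nat) y : s_ n @[n --> \oo] --> +oo ->
  psi (s_ n * y) @[n --> \oo] --> psi_oo y.
Proof.
move=> soo; apply: cvg_blowdown => //; apply: cvgM.
- exact: cvg_primitive0_pinfty.
- by apply: cvg_hopf_cole; exact: cvg_primitive0_pinfty.
- exact: cvg_primitive0_ninfty.
- by apply: cvg_hopf_cole; exact: cvg_primitive0_ninfty.
Qed.

End explicit_formulas.

End hopf_cole.

(** * The four long-time limits *)

Section long_time.
Context {R : realType}.
Variables (alpha eps : R) (u0 v0 : R -> R).
Hypotheses (alpha_neq0 : alpha != 0) (eps0 : 0 < eps).

Local Notation mu := (@lebesgue_measure R).
Hypotheses (iu0 : mu.-integrable [set: R] (EFin \o u0))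
  (iv0 : mu.-integrable [set: R] (EFin \o v0)).

Local Notation phi := (hopf_cole eps u0).
Local Notation psi := (hopf_cole_V eps u0 v0).
Local Notation rate s := ((4 * eps * s)^-1).
Local Notation sigma t := (Num.sqrt (2 * eps * tau alpha t)).

Let mphi := measurable_hopf_cole eps iu0.
Let mpsi := measurable_hopf_cole_V eps iu0 iv0.
Let m0 := expR_gt0 (- (\int[mu]_s `|u0 s| / (2 * eps))).
Let mM := hopf_cole_bounds eps0 iu0.
Let psiM := normr_hopf_cole_V eps0 iu0 iv0.

(** Case 1 holds the data constant in the general limit lemmas, Case 2 the rate 1/2. *)
Let cst_cvg (a : R) : a @[n --> \oo] --> a. Proof. exact: cvg_cst. Qed.

Let near_tau_gt0 (t_ : R^nat) : t_ n @[n --> \oo] --> +oo ->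
  \forall n \near \oo, 0 < tau alpha (t_ n).
Proof.
move=> too; near=> n; apply: tau_gt0 => //.
by near: n; exact: cvgry_gt.
Unshelve. all: end_near. Qed.

Lemma cvg_rate (t_ : R^nat) : 0 < alpha -> t_ n @[n --> \oo] --> +oo ->
  rate (tau alpha (t_ n)) @[n --> \oo] --> rate (1 / alpha).
Proof.
move=> a0 too; apply: cvgV; first by rewrite !mulf_neq0 ?invr_neq0 ?gt_eqF.
by apply: cvgM; [exact: cvg_cst|exact: cvg_tau_gt0].
Qed.

Lemma u_long_time_gt0 : 0 < alpha ->
  {family compact,
    (fun x : R => -1 / (2 * eps) * expR (alpha * t) * u_eps alpha eps u0 x t)
      @[t --> +oo] -->
    (fun x : R => derive1 (G alpha eps u0) x / G alpha eps u0 x)}.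
Proof.
move=> a0; apply: seq_cvg_family_compact => t_ x_ x too xx.
have c0 : 0 < rate (1 / alpha) by rewrite rate_gt0// divr_gt0.
rewrite GE// (derive1_gconv x c0 mphi (bounded_normr m0 mM)).
have := cvg_dlog_gconv c0 (cvg_rate a0 too) xx (fun=> mphi) mphi m0
  (fun=> mM) (fun y => @cst_cvg (phi y)).
(* The explicit formula requires tau > 0, which holds for large n; eventual equality is enough for
   the limit. *)
apply: cvg_trans; apply: near_eq_cvg; near=> n.
have tn : 0 < tau alpha (t_ n) by near: n; exact: near_tau_gt0.
rewrite u_epsE//.
have e1 : expR (alpha * t_ n) * expR (- alpha * t_ n) = 1.
  by rewrite -expRD mulNr subrr expR0.
set D := dlog_gconv _ _ _; rewrite -[LHS]mul1r -[X in X * _ = _]e1.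
by field; rewrite gt_eqF.
Unshelve. all: end_near. Qed.

Lemma v_long_time_gt0 : 0 < alpha ->
  {family compact, (fun x : R => v_eps alpha eps u0 v0 x t) @[t --> +oo] -->
    derive1 (fun x : R => H alpha eps u0 v0 x / G alpha eps u0 x)}.
Proof.
move=> a0; apply: seq_cvg_family_compact => t_ x_ x too xx.
have s0 : 0 < 1 / alpha by rewrite divr_gt0.
have c0 := rate_gt0 eps0 s0.
rewrite GE// HE// derive1_V_quot//.
have := cvg_dquot_gconv c0 (cvg_rate a0 too) xx
  (fun=> mphi) (fun=> mpsi) mphi mpsi m0 (fun=> mM) (fun=> psiM)
  (fun y => @cst_cvg (phi y)) (fun y => @cst_cvg (psi y)).
apply: cvg_trans; apply: near_eq_cvg; near=> n.
by rewrite v_epsE//; near: n; exact: near_tau_gt0.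
Unshelve. all: end_near. Qed.

Let cvg_sigma (t_ : R^nat) : alpha < 0 -> t_ n @[n --> \oo] --> +oo ->
  sigma (t_ n) @[n --> \oo] --> +oo.
Proof.
move=> a0 too; have tauoo := cvg_tau_lt0 a0 too; apply/cvgryPge => A.
near=> n.
have tn : A ^+ 2 / (2 * eps) <= tau alpha (t_ n) by near: n; exact: cvgry_ge.
rewrite (le_trans (ler_norm A))// -sqrtr_sqr ler_wsqrtr//.
by rewrite mulrC -ler_pdivrMr// mulr_gt0.
Unshelve. all: end_near. Qed.

(** This is why sigma is the right scale: the rescaled rate is 1/2 at every time, and only the data
    still move. *)
Let rate_sigma t : 0 < tau alpha t -> rate (tau alpha t) * sigma t ^+ 2 = 2^-1.
Proof.
move=> t0; rewrite sqr_sqrtr; last by rewrite ltW// mulr_gt0// mulr_gt0.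
by field; rewrite !gt_eqF.
Qed.

Let sigma_gt0 t : 0 < tau alpha t -> 0 < sigma t.
Proof. by move=> t0; rewrite sqrtr_gt0 mulr_gt0// mulr_gt0. Qed.

Let half_gt0 : 0 < 2^-1 :> R. Proof. by rewrite invr_gt0. Qed.

Local Notation phi_oo := (hopf_cole_oo eps u0).
Local Notation psi_oo := (hopf_cole_V_oo eps u0 v0).

Lemma u_long_time_lt0 : alpha < 0 ->
  {family compact,
    (fun xi : R => - Num.sqrt (tau alpha t) / Num.sqrt (2 * eps)
       * expR (alpha * t)
       * u_eps alpha eps u0 (Num.sqrt (2 * eps * tau alpha t) * xi) t)
      @[t --> +oo] -->
    (fun xi : R => derive1 (G_inf eps u0) xi / G_inf eps u0 xi)}.
Proof.
move=> a0; apply: seq_cvg_family_compact => t_ x_ x too xx.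
have phioo (y : R) : phi (sigma (t_ n) * y) @[n --> \oo] --> phi_oo y.
  by apply: cvg_phi_oo => //; exact: cvg_sigma.
have mphioo : measurable_fun [set: R] phi_oo by exact: measurable_blowdown.
(* The bounds pass to the step data, so [G_inf] is positive and its derivative formula applies. *)
have boo (y : R) := cvg_bounds (fun n => mM (sigma (t_ n) * y)) (@phioo y).
rewrite G_infE (derive1_gconv x half_gt0 mphioo (bounded_normr m0 boo)).
have mphis s : measurable_fun [set: R] (fun y => phi (s * y)) by exact: measurableT_comp.
have := cvg_dlog_gconv half_gt0 (@cst_cvg 2^-1) xx (fun n => mphis (sigma (t_ n)))
   mphioo m0 (fun n y => mM (sigma (t_ n) * y)) phioo.
apply: cvg_trans; apply: near_eq_cvg; near=> n.
have tn : 0 < tau alpha (t_ n) by near: n; exact: near_tau_gt0.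
rewrite u_epsE// -(rate_sigma tn).
rewrite -(dlog_gconv_scale (rate_gt0 eps0 tn) (sigma_gt0 tn) mphi m0 mM).
have e1 : expR (alpha * t_ n) * expR (- alpha * t_ n) = 1.
  by rewrite -expRD mulNr subrr expR0.
have e20 : 0 <= 2 * eps by rewrite ltW// mulr_gt0.
(* The exponentials cancel, and 2 eps = sqrt(2 eps)^2 turns the remaining prefactor into sqrt(2 eps)
   sqrt(tau) = sigma. *)
set D := dlog_gconv _ _ _; rewrite -[LHS]mul1r -[X in X * _ = _]e1 sqrtrM//.
rewrite -[in - (2 * eps)](sqr_sqrtr e20).
by field; rewrite gt_eqF// sqrtr_gt0 mulr_gt0.
Unshelve. all: end_near. Qed.

Lemma v_long_time_lt0 : alpha < 0 ->
  {family compact,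
    (fun xi : R => Num.sqrt (2 * eps * tau alpha t)
       * v_eps alpha eps u0 v0 (Num.sqrt (2 * eps * tau alpha t) * xi) t)
      @[t --> +oo] -->
    derive1 (fun xi : R => H_inf eps u0 v0 xi / G_inf eps u0 xi)}.
Proof.
move=> a0; apply: seq_cvg_family_compact => t_ x_ x too xx.
have phioo (y : R) : phi (sigma (t_ n) * y) @[n --> \oo] --> phi_oo y.
  by apply: cvg_phi_oo => //; exact: cvg_sigma.
have psioo (y : R) : psi (sigma (t_ n) * y) @[n --> \oo] --> psi_oo y.
  by apply: cvg_psi_oo => //; exact: cvg_sigma.
have mphioo : measurable_fun [set: R] phi_oo by exact: measurable_blowdown.
have mpsioo : measurable_fun [set: R] psi_oo by exact: measurable_blowdown.
have boo (y : R) := cvg_bounds (fun n => mM (sigma (t_ n) * y)) (@phioo y).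
have psib (n : nat) (y : R) := psiM (sigma (t_ n) * y).
(* The bound on the rescaled data passes to the limit, as the derivative formula for [H_inf] /
   [G_inf] requires. *)
have psioob (y : R) : `|psi_oo y| <= \int[mu]_s `|v0 s| * expR (\int[mu]_s `|u0 s| / (2 * eps)).
  by apply: (cvgr_to_le (cvg_norm (@psioo y))); apply: nearW.
rewrite G_infE H_infE (derive1_quot_gconv x half_gt0 mphioo mpsioo m0 boo psioob).
have mphis s : measurable_fun [set: R] (fun y => phi (s * y)) by exact: measurableT_comp.
have mpsis s : measurable_fun [set: R] (fun y => psi (s * y)) by exact: measurableT_comp.
have := cvg_dquot_gconv half_gt0 (@cst_cvg 2^-1) xx (fun n => mphis (sigma (t_ n)))
  (fun n => mpsis (sigma (t_ n))) mphioo mpsioo m0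
  (fun n y => mM (sigma (t_ n) * y)) psib phioo psioo.
apply: cvg_trans; apply: near_eq_cvg; near=> n.
have tn : 0 < tau alpha (t_ n) by near: n; exact: near_tau_gt0.
rewrite v_epsE// -(rate_sigma tn).
by rewrite -(dquot_gconv_scale (rate_gt0 eps0 tn) (sigma_gt0 tn) mphi mpsi m0 mM psiM).
Unshelve. all: end_near. Qed.

End long_time.

Theorem theorem3p2 (R : realType) (alpha eps : R) (u0 v0 : R -> R)
    (alpha_neq0 : alpha != 0) (eps_gt0 : 0 < eps)
    (u0_Linfty : u0 \in Lfun (@lebesgue_measure R) +oo%E)
    (u0_L1 : u0 \in Lfun (@lebesgue_measure R) 1%E)
    (v0_BV : bounded_variation_line v0)
    (v0_L1 : v0 \in Lfun (@lebesgue_measure R) 1%E) :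
  (0 < alpha ->
    {family compact,
      (fun x : R => -1 / (2 * eps) * expR (alpha * t) * u_eps alpha eps u0 x t)
        @[t --> +oo] -->
      (fun x : R => derive1 (G alpha eps u0) x / G alpha eps u0 x)} /\
    {family compact,
      (fun x : R => v_eps alpha eps u0 v0 x t) @[t --> +oo] -->
      derive1 (fun x : R => H alpha eps u0 v0 x / G alpha eps u0 x)}) /\
  (alpha < 0 ->
    {family compact,
      (fun xi : R => - Num.sqrt (tau alpha t) / Num.sqrt (2 * eps)
         * expR (alpha * t)
         * u_eps alpha eps u0 (Num.sqrt (2 * eps * tau alpha t) * xi) t)
        @[t --> +oo] -->
      (fun xi : R => derive1 (G_inf eps u0) xi / G_inf eps u0 xi)} /\
    {family compact,
      (fun xi : R => Num.sqrt (2 * eps * tau alpha t)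
         * v_eps alpha eps u0 v0 (Num.sqrt (2 * eps * tau alpha t) * xi) t)
        @[t --> +oo] -->
      derive1 (fun xi : R => H_inf eps u0 v0 xi / G_inf eps u0 xi)}).
Proof.
have iu0 := (Lfun1_integrable _ _).1 u0_L1.
have iv0 := (Lfun1_integrable _ _).1 v0_L1.
split=> a0; split.
- exact: u_long_time_gt0.
- exact: v_long_time_gt0.
- exact: u_long_time_lt0.
- exact: v_long_time_lt0.
Qed.
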